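(* Let $(\mathcal{E},\mathcal{F})$ be a resistance form on a set $X\neq\emptyset$, and let $\varrho_{\mathcal{E}}(x,y)=\sup\{|f(x)-f(y)|\mid f\in\mathcal{F},\ \mathcal{E}(f)\le 1\}$ for $x,y\in X$. The following assertions are equivalent: (i) $\mathcal{F}\subseteq\ell^\infty(X)$, i.e. every function in $\mathcal{F}$ is bounded. (ii) $\varrho_{\mathcal{E}}$ is bounded, i.e. $\sup_{x,y\in X}\varrho_{\mathcal{E}}(x,y)<\infty$. (iii) $\mathcal{F}$ is an algebra (with respect to pointwise addition and multiplication of functions), i.e. $fg\in\mathcal{F}$ for all $f,g\in\mathcal{F}$.
   Context: A resistance form (in the sense of Kigami) on a set $X\ne\emptyset$ is a pair $(\mathcal{E},\mathcal{F})$ such that, writing $\mathcal{E}(u)=\mathcal{E}(u,u)$: (RF1) $\mathcal{F}$ is a linear subspace of the space of all functions $X\to\mathbb{R}$ containing the constant functions, and $\mathcal{E}:\mathcal{F}\times\mathcal{F}\to\mathbb{R}$ is a nonnegative symmetric bilinear form with $\mathcal{E}(u)=0$ if and only if $u$ is constant on $X$. (RF2) If $\sim$ is the equivalence relation on $\mathcal{F}$ given by $u\sim v$ iff $u-v$ is constant, then $(\mathcal{F}/{\sim},\mathcal{E})$ is a Hilbert space. (RF3) For every finite subset $V\subseteq X$ and every function $v:V\to\mathbb{R}$ there is $u\in\mathcal{F}$ with $u|_V=v$. (RF4) For all $p,q\in X$, $\sup\{|u(p)-u(q)|^2/\mathcal{E}(u)\mid u\in\mathcal{F},\ \mathcal{E}(u)>0\}$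 is finite. (RF5) If $u\in\mathcal{F}$, then $\bar u=\min(\max(u,0),1)\in\mathcal{F}$ and $\mathcal{E}(\bar u)\le\mathcal{E}(u)$. The function $\varrho_{\mathcal{E}}$ is the square root of the resistance metric associated with $(\mathcal{E},\mathcal{F})$. *)

(* Defs.v *)
(* MathComp-Analysis; the real numbers are an arbitrary R : realType. *)
From HB Require Import structures.
From mathcomp Require Import all_boot all_order all_algebra.
From mathcomp Require Import all_classical all_reals all_analysis.

Set Implicit Arguments.
Unset Strict Implicit.
Unset Printing Implicit Defensive.

Import Order.TTheory GRing.Theory Num.Theory.
Import numFieldNormedType.Exports.

Local Open Scope classical_set_scope.
Local Open Scope ring_scope.
Local Open Scope quotient_scope.

Section Forms.
Variables (R : realType) (V : lmodType R).
Implicit Types (S : set V) (B : V -> V -> R).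

Definition linear_subspace S : Prop :=
  S 0 /\ forall (a : R) (u v : V), S u -> S v -> S (a *: u + v).

(* A form on S is a total function on V whose values outside S are
   irrelevant. Linearity in the second argument follows from symmetry. *)
Definition symmetric_bilinear_on S B : Prop :=
  (forall u v, S u -> S v -> B u v = B v u) /\
  (forall (a : R) (u v w : V), S u -> S v -> S w ->
     B (a *: u + v) w = a * B u w + B v w).

Definition nonneg_on S B : Prop := forall u, S u -> 0 <= B u u.

Definition form_norm B (u : V) : R := Num.sqrt (B u u).

Definition form_complete S B : Prop :=
  forall u : nat -> V, (forall n, S (u n)) ->
    (forall e : R, 0 < e -> exists N, forall m n, (N <= m)%N -> (N <= n)%N ->
       form_norm B (u m - u n) < e) ->
    exists2 l, S l & form_norm B (u n - l) @[n --> \oo] --> 0.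

Definition hilbert_space S B : Prop :=
  [/\ linear_subspace S,
      symmetric_bilinear_on S B,
      nonneg_on S B,
      (forall u, S u -> B u u = 0 -> u = 0) &
      form_complete S B].

End Forms.

Section ModConstants.
Variables (R : realType) (X : Type).

Definition is_constant (f : X -> R) : Prop := exists c : R, f = cst c.

Definition constants : {pred X -> R} := fun f => `[< is_constant f >].

Lemma constants_zmod_closed : zmod_closed constants.
Proof.
split=> [|f g]; first by apply/asboolP; exists 0.
move=> /asboolP[a ->] /asboolP[b ->]; apply/asboolP; exists (a - b).
exact/funext.
Qed.

HB.instance Definition _ :=
  GRing.isZmodClosed.Build (X -> R) constants constants_zmod_closed.

(* The space of all functions modulo constants, of which F / ~ is a subspace. *)
Local Notation Q := (Quotient.quot constants).

Lemma constantsZ (a : R) (f : X -> R) : f \in constants -> a *: f \in constants.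
Proof.
by move=> /asboolP[c ->]; apply/asboolP; exists (a * c); exact/funext.
Qed.

Lemma pi_add (f g : X -> R) : \pi_Q (f + g) = \pi_Q f + \pi_Q g.
Proof. exact: Quotient.pi_add. Qed.

Definition quot_scale (a : R) (q : Q) : Q := \pi_Q (a *: repr q).

Lemma pi_scale (a : R) (f : X -> R) : quot_scale a (\pi_Q f) = \pi_Q (a *: f).
Proof.
apply/eqP; rewrite /quot_scale -Quotient.idealrBE -scalerBr constantsZ //.
by rewrite Quotient.idealrBE reprK.
Qed.

Fact quot_scaleA a b q : quot_scale a (quot_scale b q) = quot_scale (a * b) q.
Proof. by rewrite -[q]reprK (pi_scale b) !pi_scale scalerA. Qed.

Fact quot_scale1 : left_id 1 quot_scale.
Proof. by move=> q; rewrite -[q]reprK pi_scale scale1r. Qed.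

Fact quot_scaleDr : right_distributive quot_scale +%R.
Proof.
move=> a p q; rewrite -[p]reprK -[q]reprK -pi_add !pi_scale.
by rewrite -pi_add -scalerDr.
Qed.

Fact quot_scaleDl q : {morph quot_scale^~ q : a b / a + b}.
Proof.
by move=> a b; rewrite -[q]reprK !pi_scale -pi_add -scalerDl.
Qed.

HB.instance Definition _ := GRing.Zmodule_isLmodule.Build R Q
  quot_scaleA quot_scale1 quot_scaleDr quot_scaleDl.

Definition quot_by_constants (F : set (X -> R)) : set Q :=
  [set \pi_Q u | u in F].

(* When (E, F) satisfies RF1, this does not depend on the representatives of
   classes of elements of F: constants are E-orthogonal to F. *)
Definition quot_form (E : (X -> R) -> (X -> R) -> R) (p q : Q) : R :=
  E (repr p) (repr q).

End ModConstants.

Arguments constants : clear implicits.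

Section ResistanceForms.
Variables (R : realType) (X : Type).

Definition unit_clip (u : X -> R) : X -> R :=
  fun x => Num.min (Num.max (u x) 0) 1.

(* In RF4 finiteness of the supremum is boundedness above of the set, which is
   empty when X is a singleton. *)
Record resistance_form (E : (X -> R) -> (X -> R) -> R) (F : set (X -> R)) : Prop
  := ResistanceForm {
  RF1_subspace : linear_subspace F;
  RF1_cst : forall c : R, F (cst c);
  RF1_bilinear : symmetric_bilinear_on F E;
  RF1_nonneg : nonneg_on F E;
  RF1_kernel : forall u, F u -> (E u u = 0 <-> is_constant u);
  RF2 : hilbert_space (quot_by_constants F) (quot_form E);
  RF3 : forall V : set X, finite_set V -> forall v : V -> R,
    exists2 u, F u & forall x : V, u (val x) = v x;
  RF4 : forall p q : X,
    has_ubound [set `|u p - u q| ^+ 2 / E u u | u in [set u | F u /\ 0 < E u u]];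
  RF5 : forall u, F u ->
    F (unit_clip u) /\ E (unit_clip u) (unit_clip u) <= E u u
}.

(* The defining supremum is taken in the extended reals, so that its finiteness
   is not built in. *)
Definition rho (E : (X -> R) -> (X -> R) -> R) (F : set (X -> R)) (x y : X) :
    \bar R :=
  ereal_sup [set (`|f x - f y|)%:E | f in [set f | F f /\ E f f <= 1]].

End ResistanceForms.

(* Main.v *)
(** A series of functions [u_n] in [F] with [E(u_n) <= (c 2^-n)^2] converges in
    [F], and pointwise up to a constant.

    If [rho] is unbounded, fix a base point [o] and points [x_n] with
    [r_n = rho(x_n, o) >= 8^n]. Truncating near-optimal functions gives
    nonnegative [f_n] in the unit ball with [f_n(o) = 0] and
    [f_n(x_n) >= r_n / 2]. Their weighted sum [f = \sum_n 2^-n f_n] is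
    unbounded, and [f^2] is not in [F], since [f(x_n)^2 >= 4^-n r_n^2 / 4]
    outgrows the bound [r_n * sqrt (E (f^2))].

    Conversely, [rho] bounded makes every function in [F] bounded, and it remains
    to see that [F] contains [u^2] when [0 <= u <= 1]. There
    [u - u^2 = \sum_(n >= 1) 4^-n T^n(u)] for the tent map
    [T(t) = 1 - |1 - 2t|]. The Markov property gives [E(|v|) <= E(v)], hence
    [E(T^n(u)) <= 4^n E(u)], so the series converges in [F]. *)
Require Import Defs.
From mathcomp Require Import all_boot all_order all_algebra.
From mathcomp Require Import all_classical all_reals all_analysis.
From mathcomp Require Import ring lra.

Import Order.TTheory GRing.Theory Num.Theory.
Import numFieldNormedType.Exports.

Local Open Scope classical_set_scope.
Local Open Scope ring_scope.

Section ResistanceFormTheory.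
Context (R : realType) (X : Type).
Context (E : (X -> R) -> (X -> R) -> R) (F : set (X -> R)).
Hypothesis hEF : resistance_form E F.
Implicit Types (u v : X -> R) (a b c : R).

(** * Linear structure of the domain and Cauchy-Schwarz for the energy *)

Lemma dom_lin a u v : F u -> F v -> F (a *: u + v).
Proof. by case: (RF1_subspace hEF) => _; apply. Qed.

Lemma dom0 : F 0.
Proof. by case: (RF1_subspace hEF). Qed.

Lemma domZ a u : F u -> F (a *: u).
Proof.
by move=> Fu; rewrite -[_ *: _]addr0; apply: dom_lin => //; exact: dom0.
Qed.

Lemma domD u v : F u -> F v -> F (u + v).
Proof. by move=> Fu Fv; rewrite -[u]scale1r; apply: dom_lin. Qed.

Lemma domB u v : F u -> F v -> F (u - v).
Proof. by move=> Fu Fv; rewrite addrC -scaleN1r; apply: dom_lin. Qed.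

Lemma dom_sum (u : nat -> X -> R) m n :
  (forall k, F (u k)) -> F (\sum_(m <= k < n) u k).
Proof.
by move=> Fu; apply: big_ind => //; [exact: dom0 | exact: domD].
Qed.

Lemma energyDl a u v w : F u -> F v -> F w ->
  E (a *: u + v) w = a * E u w + E v w.
Proof. by case: (RF1_bilinear hEF) => _; apply. Qed.

Lemma energyC u v : F u -> F v -> E u v = E v u.
Proof. by case: (RF1_bilinear hEF) => + _; apply. Qed.

Lemma energy_ge0 u : F u -> 0 <= E u u.
Proof. exact: (RF1_nonneg hEF). Qed.

Lemma energy_cst c : E (cst c) (cst c) = 0.
Proof. by apply/(RF1_kernel hEF); [exact: (RF1_cst hEF) | exists c]. Qed.

Lemma energy0 : E 0 0 = 0.
Proof. exact: (energy_cst 0). Qed.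

Lemma energy_lin a u v : F u -> F v ->
  E (a *: u + v) (a *: u + v) = a ^+ 2 * E u u + 2 * a * E u v + E v v.
Proof.
move=> Fu Fv; have Fw := dom_lin a u v Fu Fv.
rewrite energyDl // (energyC u) // (energyC v _ Fv Fw) !energyDl //.
rewrite (energyC v u) //; ring.
Qed.

Lemma energyZ a u : F u -> E (a *: u) (a *: u) = a ^+ 2 * E u u.
Proof.
move=> Fu; have := energy_lin a u 0 Fu dom0.
have := energyDl (-1) 0 0 u dom0 dom0 Fu.
rewrite scaler0 addr0 (energyC 0 u dom0 Fu) => E0.
have {}E0 : E u 0 = 0 by lra.
by rewrite addr0 E0 energy0 mulr0 !addr0.
Qed.

(** Cauchy-Schwarz, from [0 <= E(v - (b/a) u)]. Positive bounds [a], [b] in place of the norms avoid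
    dividing by a vanishing energy. *)
Lemma energy_le_mul a b u v : F u -> F v -> 0 < a -> 0 < b ->
  E u u <= a ^+ 2 -> E v v <= b ^+ 2 -> E u v <= a * b.
Proof.
move=> Fu Fv a0 b0 Eu Ev.
have := energy_ge0 _ (dom_lin (- (b / a)) u v Fu Fv).
rewrite energy_lin //.
set t := b / a => h.
have t0 : 0 < t by rewrite divr_gt0.
have bE : b = t * a by rewrite /t divfK // gt_eqF.
rewrite bE in Ev *.
have h1 : 2 * t * E u v <= 2 * t * (a * (t * a)).
  have : t ^+ 2 * E u u <= t ^+ 2 * a ^+ 2 by rewrite ler_wpM2l // sqr_ge0.
  by rewrite !expr2 in h Ev *; lra.
by rewrite ler_pM2l // in h1; lra.
Qed.

Lemma energyD_le a b u v : F u -> F v -> 0 < a -> 0 < b ->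
  E u u <= a ^+ 2 -> E v v <= b ^+ 2 -> E (u + v) (u + v) <= (a + b) ^+ 2.
Proof.
move=> Fu Fv a0 b0 Eu Ev.
have := energy_le_mul a b u v Fu Fv a0 b0 Eu Ev.
rewrite -[u in E (u + _)]scale1r -[X in E _ (X + _)]scale1r energy_lin //.
rewrite !expr2 in Eu Ev *; lra.
Qed.

(** A constant has zero energy, so its bound in Cauchy-Schwarz may be any positive number; here it
    is chosen to make the product [e]. Replacing [u] by [-u] then gives equality in
    [energy_cstr]. *)
Lemma energy_cst_le0 u c : F u -> E u (cst c) <= 0.
Proof.
move=> Fu.
have a0 : 0 < E u u + 1 by rewrite ltr_wpDl // energy_ge0.
have Eu : E u u <= (E u u + 1) ^+ 2.
  by have := energy_ge0 u Fu; rewrite expr2; nra.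
apply/ler_addgt0Pl => e e0; rewrite addr0.
have := energy_le_mul _ (e / (E u u + 1)) _ _ Fu (RF1_cst hEF c) a0 _ Eu.
rewrite energy_cst mulrCA mulfV ?gt_eqF// mulr1; apply; last exact: sqr_ge0.
by rewrite divr_gt0.
Qed.

Lemma energy_cstr u c : F u -> E u (cst c) = 0.
Proof.
move=> Fu; apply/eqP; rewrite eq_le energy_cst_le0 //=.
have := energy_cst_le0 (-1 *: u + 0) c (dom_lin _ _ _ Fu dom0).
have E0 : E 0 (cst c) = 0.
  have := energyDl (-1) 0 0 (cst c) dom0 dom0 (RF1_cst hEF c).
  by rewrite scaler0 addr0; lra.
rewrite energyDl ?E0 //; [lra|exact: dom0|exact: (RF1_cst hEF)].
Qed.

Lemma energy_affine a c u : F u ->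
  F (fun x => a * u x + c) /\
  E (fun x => a * u x + c) (fun x => a * u x + c) = a ^+ 2 * E u u.
Proof.
move=> Fu; have -> : (fun x => a * u x + c) = a *: u + cst c by exact/funext.
split; first by apply: dom_lin => //; exact: (RF1_cst hEF).
rewrite energy_lin // ?energy_cst ?energy_cstr //; first by ring.
exact: (RF1_cst hEF).
Qed.

(** * The Markov property for absolute values *)

Lemma energy_normr u : F u -> (forall x, `|u x| <= 1) ->
  F (fun x => `|u x|) /\ E (fun x => `|u x|) (fun x => `|u x|) <= E u u.
Proof.
move=> Fu u1.
set p := unit_clip u; set m := unit_clip (-1 *: u).
have Fp : F p by exact: (RF5 hEF Fu).1.
have Fm : F m by exact: (RF5 hEF (domZ (-1) u Fu)).1.
have pmE x : (0 <= u x /\ p x = u x /\ m x = 0) \/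
             (u x <= 0 /\ p x = 0 /\ m x = - u x).
  have := u1 x; rewrite ler_norml => /andP[l1 l2].
  rewrite /p /m /unit_clip /= !fctE /GRing.scale /= mulN1r.
  case/orP: (le_total 0 (u x)) => ux; [left|right].
  - by split=> //; rewrite (max_l ux) (@max_r _ _ (- u x)) ?oppr_le0// !min_l.
  - by split=> //; rewrite (max_r ux) (@max_l _ _ (- u x)) ?oppr_ge0// !min_l//;
      lra.
(* As [|u| <= 1], the clips [p] and [m] are exactly the positive and negative parts of [u]. Hence
   [E(|u|) - E(u) = 4 E(m, p)], and only the sign of [E(m, p)] matters. *)
have uE : u = -1 *: m + p.
  apply/funext => x; rewrite !fctE /GRing.scale /=.
  by case: (pmE x) => -[_ [-> ->]]; lra.
have nE : (fun x => `|u x|) = 1 *: m + p.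
  apply/funext => x; rewrite !fctE /GRing.scale /=.
  case: (pmE x) => -[ux [-> ->]].
  - by rewrite ger0_norm //; lra.
  - by rewrite ler0_norm //; lra.
(* Truncating [p - d m] yields [p], so [E p p <= E (p - d m) (p - d m)]; let
   [d] tend to [0]. *)
have Emp : E m p <= 0.
  apply/ler_addgt0Pl => e e0; rewrite addr0.
  have Em := energy_ge0 m Fm.
  pose d := e / (E m m + 1).
  have d0 : 0 < d by rewrite divr_gt0 // ltr_wpDl.
  have dE : d * E m m + d = e.
    by rewrite -{2}[d]mulr1 -mulrDr divfK // gt_eqF // ltr_wpDl.
  have clipE : unit_clip (- d *: m + p) = p.
    apply/funext => x; rewrite /unit_clip !fctE /GRing.scale /=.
    have := u1 x; rewrite ler_norml => /andP[l1 l2].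
    case: (pmE x) => -[ux [-> ->]].
    - by rewrite mulr0 add0r max_l // min_l.
    - rewrite max_r ?min_l//; nra.
  have := (RF5 hEF (dom_lin (- d) _ _ Fm Fp)).2.
  rewrite clipE energy_lin // => h.
  have : d * (2 * E m p) <= d * (d * E m m) by rewrite expr2 in h; lra.
  rewrite ler_pM2l//; nra.
rewrite nE; split; first exact: dom_lin.
rewrite [in leRHS]uE !energy_lin //; lra.
Qed.

(** * Pointwise estimates through the resistance metric *)

Lemma rho_fin x y : exists2 r, rho E F x y = r%:E & 0 <= r.
Proof.
have r0 : (0 <= rho E F x y)%E.
  apply: ereal_sup_ubound => /=; exists 0.
    by rewrite energy0; split=> //; exact: dom0.
  by rewrite subrr normr0.
have [M hM] := RF4 hEF x y.
have : (rho E F x y <= (1 + `|M|)%:E)%E.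
  apply: ge_ereal_sup => _ [f [Ff Ef1] <-]; rewrite lee_fin.
  have [Ef0|Ef0] := eqVneq (E f f) 0.
    have /(RF1_kernel hEF Ff)[c ->] := Ef0.
    by rewrite subrr normr0 addr_ge0.
  have Ef : 0 < E f f by rewrite lt_def Ef0 energy_ge0.
  have : `|f x - f y| ^+ 2 / E f f <= M by apply: hM; exists f.
  rewrite ler_pdivrMr // => h.
  (* RF4 bounds the square; [t^2 <= |M|] implies [t <= 1 + |M|]. *)
  have : `|f x - f y| ^+ 2 <= `|M|.
    apply: (le_trans h); have := ler_norm M; have := normr_ge0 M; nra.
  have := normr_ge0 (f x - f y); have := normr_ge0 M; rewrite expr2; nra.
case: (rho E F x y) r0 => [r| |] //=; rewrite ?lee_fin; by exists r.
Qed.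

(** Rescale [u] to unit energy; at zero energy [u] is constant. *)
Lemma rho_bound x y r u : rho E F x y = r%:E -> F u ->
  `|u x - u y| <= r * Num.sqrt (E u u).
Proof.
move=> hr Fu.
have [Eu0|Eu0] := eqVneq (E u u) 0.
  have /(RF1_kernel hEF Fu)[c ->] := Eu0.
  by rewrite energy_cst sqrtr0 mulr0 subrr normr0.
have Eu : 0 < Num.sqrt (E u u) by rewrite sqrtr_gt0 lt_def Eu0 energy_ge0.
rewrite -ler_pdivrMr // -lee_fin -hr; apply: ereal_sup_ubound => /=.
exists ((Num.sqrt (E u u))^-1 *: u).
  split; first exact: domZ.
  by rewrite energyZ // exprVn sqr_sqrtr ?energy_ge0 // mulVf.
by rewrite !fctE /GRing.scale /= -mulrBr normrM gtr0_norm ?invr_gt0// mulrC.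
Qed.

(** * Completeness modulo constants and convergent series *)

Local Notation Q := (Quotient.quot (constants R X)).

Lemma quot_form_pi u : F u ->
  quot_form E (\pi_Q u)%qT (\pi_Q u)%qT = E u u.
Proof.
move=> Fu; rewrite /quot_form.
have : repr (\pi_Q u : Q)%qT - u \in constants R X.
  by rewrite Quotient.idealrBE reprK.
set w := repr _ => /asboolP[c wu].
have -> : w = (fun x => 1 * u x + c).
  by apply/funext => x; have := congr1 (@^~ x) wu; rewrite /= !fctE; lra.
by rewrite (energy_affine 1 c u Fu).2; ring.
Qed.

(** Lifts RF2 from the quotient to the seminorm on [F]; the limit is determined only up to a
    constant. *)
Lemma dom_complete (u : nat -> X -> R) : (forall n, F (u n)) ->
  (forall e, 0 < e -> exists N, forall m n, (N <= m)%N -> (N <= n)%N ->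
     form_norm E (u m - u n) < e) ->
  exists2 l, F l & form_norm E (u n - l) @[n --> \oo] --> 0.
Proof.
move=> Fu uC; case: (RF2 hEF) => _ _ _ _ compl.
have piB v w : (\pi_Q v - \pi_Q w)%qT = (\pi_Q (v - w))%qT :> Q.
  by rewrite Defs.pi_add; congr (_ + _); rewrite Quotient.pi_opp.
have normE v w : F v -> F w ->
    form_norm (quot_form E) (\pi_Q v - \pi_Q w)%qT = form_norm E (v - w).
  by move=> Fv Fw; rewrite piB /form_norm quot_form_pi //; exact: domB.
have [|e e0|_ [l Fl <-] h] := compl (fun n => \pi_Q (u n))%qT.
- by move=> n; exists (u n).
- have [N hN] := uC e e0; exists N => m n Nm Nn.
  by rewrite normE //; exact: hN.
exists l => //; apply: cvg_trans h; apply: near_eq_cvg; near=> n.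
by rewrite normE.
Unshelve. all: by end_near. Qed.

(** The triangle inequality with a geometric series: peeling off the first term uses
    [c 2^-m + 2 c 2^-(m+1) = 2 c 2^-m]. *)
Lemma energy_sum_le c (u : nat -> X -> R) : 0 < c -> (forall k, F (u k)) ->
  (forall k, E (u k) (u k) <= (c * 2^-1 ^+ k) ^+ 2) ->
  forall n m, E (\sum_(m <= k < n) u k) (\sum_(m <= k < n) u k) <=
    (2 * c * 2^-1 ^+ m) ^+ 2.
Proof.
move=> c0 Fu Eu n m; have p0 k : 0 < 2^-1 ^+ k :> R by rewrite exprn_gt0.
have [d] := ubnP (n - m); elim: d m => // d IH m dm.
have [mn|nm] := ltnP m n; last by rewrite big_geq // energy0 sqr_ge0.
rewrite big_ltn //.
have -> : 2 * c * 2^-1 ^+ m = c * 2^-1 ^+ m + 2 * c * 2^-1 ^+ m.+1 :> R.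
  by rewrite exprS; field.
apply: energyD_le; rewrite ?mulr_gt0 //; first exact: dom_sum.
by apply: IH; rewrite ltnS in dm; exact: leq_trans (ltn_sub2l mn (ltnSn m)) dm.
Qed.

(** Geometric decay makes the partial sums Cauchy. The energy does not see constants, so [rho_bound]
    controls only differences of values. *)
Lemma dom_series c (u : nat -> X -> R) : 0 < c -> (forall k, F (u k)) ->
  (forall k, E (u k) (u k) <= (c * 2^-1 ^+ k) ^+ 2) ->
  exists2 l, F l & forall x y,
    \sum_(0 <= k < n) (u k x - u k y) @[n --> \oo] --> l x - l y.
Proof.
move=> c0 Fu Eu; pose s n := \sum_(0 <= k < n) u k.
have Fs n : F (s n) by exact: dom_sum.
have sB m n : (m <= n)%N -> s n - s m = \sum_(m <= k < n) u k.
  by move=> mn; rewrite /s (@big_cat_nat _ _ _ m) //= addrAC subrr add0r.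
have norm_sub v w : F v -> F w -> form_norm E (v - w) = form_norm E (w - v).
  move=> Fv Fw; rewrite /form_norm -[v - w]opprB -scaleN1r.
  rewrite energyZ; last exact: domB.
  by rewrite sqrrN expr1n mul1r.
have nle m n : (m <= n)%N -> form_norm E (s n - s m) <= 2 * c * 2^-1 ^+ m.
  move=> mn; rewrite /form_norm sB // -[leRHS]ger0_norm -?sqrtr_sqr.
    by rewrite ler_sqrt ?sqr_ge0 //; exact: energy_sum_le.
  by rewrite !mulr_ge0 // ltW.
have [|e e0|l Fl hl] := dom_complete s; first by [].
- have : 2 * c * 2^-1 ^+ n @[n --> \oo] --> (0 : R).
    rewrite -(mulr0 (2 * c)); apply: cvgMr; apply: cvg_expr.
    by rewrite ger0_norm // invf_lt1 // ltr1n.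
  move=> /cvgr0Pnorm_lt /(_ e e0)[N _ hN]; exists N => m n Nm Nn.
  have le_small p q : (N <= p)%N -> (p <= q)%N -> form_norm E (s q - s p) < e.
    move=> Np pq; apply: le_lt_trans (nle p q pq) _.
    by apply: le_lt_trans (hN p Np); rewrite ler_norm.
  have [mn|/ltnW nm] := leqP m n; last exact: le_small.
  by rewrite norm_sub //; exact: le_small.
exists l => // x y.
have [r hr r0] := rho_fin x y.
(* The distance [r] may vanish, hence the denominator [r + 1]. *)
have Er e : 0 < e -> 0 < e / (r + 1) by move=> e0; rewrite divr_gt0 ?ltr_wpDl.
apply/cvgrPdist_le => e e0; move/cvgr0Pnorm_lt: hl => /(_ _ (Er e e0)) hl.
near=> n.
have -> : l x - l y - \sum_(0 <= k < n) (u k x - u k y) =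
          - ((s n - l) x - (s n - l) y).
  have sE z : s n z = \sum_(0 <= k < n) u k z by rewrite /s fct_sumE.
  by rewrite sumrB -!sE !fctE; lra.
rewrite normrN; apply: le_trans (rho_bound _ _ _ _ hr (domB _ _ (Fs n) Fl)) _.
have : form_norm E (s n - l) < e / (r + 1).
  by apply: le_lt_trans (ler_norm _) _; near: n.
rewrite /form_norm ltr_pdivlMr ?ltr_wpDl // => h.
by have := sqrtr_ge0 (E (s n - l) (s n - l)); nra.
Unshelve. all: by end_near. Qed.

(** * The tent map [tent t = 2 min(t, 1 - t)] and closure under products *)

Definition tent (t : R) : R := 1 - `|1 - 2 * t|.

Lemma tent01 t : 0 <= t <= 1 -> 0 <= tent t <= 1.
Proof.
move=> /andP[t0 t1]; rewrite /tent.
have : `|1 - 2 * t| <= 1 by rewrite ler_norml; lra.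
by have := normr_ge0 (1 - 2 * t); lra.
Qed.

(** The affine map [1 - 2u] multiplies the energy by 4 and takes values in [[-1, 1]], where
    [energy_normr] applies. *)
Lemma energy_tent u : F u -> (forall x, 0 <= u x <= 1) ->
  F (tent \o u) /\ E (tent \o u) (tent \o u) <= 4 * E u u.
Proof.
move=> Fu u01; have [Fv Ev] := energy_affine (-2) 1 u Fu.
set v := fun x => _ in Fv Ev.
have [|Fw Ew] := energy_normr v Fv.
  by move=> x; have /andP[] := u01 x; rewrite ler_norml /v; lra.
have -> : tent \o u = (fun x => -1 * `|v x| + 1).
  apply/funext => x /=; rewrite /tent /v mulN1r [RHS]addrC.
  by congr (_ - `|_|); ring.
have [Ft ->] := energy_affine (-1) 1 _ Fw.
by split=> //; rewrite sqrrN expr1n mul1r (le_trans Ew)// Ev; lra.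
Qed.

Lemma energy_iter_tent u n : F u -> (forall x, 0 <= u x <= 1) ->
  [/\ F (iter n tent \o u), forall x, 0 <= iter n tent (u x) <= 1 &
      E (iter n tent \o u) (iter n tent \o u) <= 4 ^+ n * E u u].
Proof.
move=> Fu u01; elim: n => [|n [Fn n01 En]]; first by rewrite mul1r.
have [Ft Et] := energy_tent _ Fn n01.
split; [exact: Ft | by move=> x; apply: tent01; exact: n01 |].
by rewrite exprS -mulrA; apply: (le_trans Et); rewrite ler_pM2l.
Qed.

(* Telescopes since [t - t^2 = (tent t + (tent t - (tent t)^2)) / 4]. *)
Lemma sum_iter_tent t n :
  \sum_(0 <= k < n) 4^-1 ^+ k.+1 * iter k.+1 tent t =
  t - t ^+ 2 - 4^-1 ^+ n * (iter n tent t - iter n tent t ^+ 2).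
Proof.
elim: n => [|n IH]; first by rewrite big_geq // expr0 mul1r subrr.
rewrite big_nat_recr //= IH (exprS 4^-1 n).
set z := iter n tent t.
suff : z - z ^+ 2 = 4^-1 * (tent z + (tent z - tent z ^+ 2)).
  by move=> ->; ring.
rewrite /tent; have [h|h] := leP 0 (1 - 2 * z).
- by rewrite ger0_norm //; field.
- by rewrite ltr0_norm //; field.
Qed.

Lemma dom_sqr01 u : F u -> (forall x, 0 <= u x <= 1) -> F (u \* u).
Proof.
move=> Fu u01.
pose v k := 4^-1 ^+ k.+1 *: (iter k.+1 tent \o u).
have Fv k : F (v k).
  by apply: domZ; case: (energy_iter_tent u k.+1 Fu u01).
have Eu := energy_ge0 u Fu.
have c0 : 0 < E u u + 1 by rewrite ltr_wpDl.
(* The squared weight [16^-(k+1)] beats the growth [4^(k+1)] of the energy. Adding 1 to [E u u]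
   keeps the constant positive and gives [E u u <= (E u u + 1)^2]. *)
have Ev k : E (v k) (v k) <= ((E u u + 1) * 2^-1 ^+ k) ^+ 2.
  have [Fk _ Ek] := energy_iter_tent u k.+1 Fu u01.
  rewrite energyZ //.
  apply: (@le_trans _ _ ((4^-1 ^+ k.+1) ^+ 2 * (4 ^+ k.+1 * E u u))).
    by rewrite ler_wpM2l // sqr_ge0.
  have q0 : 0 < 4^-1 ^+ k :> R by rewrite exprn_gt0.
  have q1 : 4^-1 ^+ k.+1 * 4 ^+ k.+1 = 1 :> R.
    by rewrite -exprMn mulVf // expr1n.
  have q2 : (2^-1 ^+ k) ^+ 2 = 4^-1 ^+ k :> R.
    by rewrite exprAC; congr (_ ^+ k); field.
  rewrite exprMn q2 expr2 mulrACA q1 mul1r exprS -mulrA mulrCA mulrC.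
  by rewrite ler_pM2r // expr2; nra.
have [l Fl hl] := dom_series _ v c0 Fv Ev.
have [[ o] | noX] := pselect (inhabited X); last first.
  by have -> : u \* u = u by apply/funext => x; case: noX.
have lim0 x : 4^-1 ^+ n * (iter n tent (u x) - iter n tent (u x) ^+ 2)
    @[n --> \oo] --> (0 : R).
  have e0 : 4^-1 ^+ n @[n --> \oo] --> (0 : R).
    by apply: cvg_expr; rewrite ger0_norm // invf_lt1 // ltr1n.
  apply: squeeze_cvgr (cvg_cst 0) e0; near=> n.
  have [_ /(_ x)/andP[h0 h1] _] := energy_iter_tent u n Fu u01.
  have p0 : 0 < 4^-1 ^+ n :> R by rewrite exprn_gt0.
  rewrite expr2; set z := iter _ _ _ in h0 h1 *.
  apply/andP; split; first by apply: mulr_ge0; [exact: ltW | nra].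
  by apply: ler_piMr; [exact: ltW | nra].
have sumE x n : \sum_(0 <= k < n) v k x = u x - u x ^+ 2
    - 4^-1 ^+ n * (iter n tent (u x) - iter n tent (u x) ^+ 2).
  exact: sum_iter_tent.
have limE x : \sum_(0 <= k < n) v k x @[n --> \oo] --> u x - u x ^+ 2.
  rewrite (funext (sumE x)) -[X in _ --> X]subr0.
  by apply: cvgB; [exact: cvg_cst | exact: lim0].
(* So [l] and [u - u^2] differ by a constant, computed at [o]. *)
have lE x : l x - l o = (u x - u x ^+ 2) - (u o - u o ^+ 2).
  apply: (cvg_unique _ (hl x o)) => //.
  have -> : (fun n => \sum_(0 <= k < n) (v k x - v k o)) =
      (fun n => \sum_(0 <= k < n) v k x - \sum_(0 <= k < n) v k o).
    by apply/funext => n; rewrite sumrB.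
  by apply: cvgB; exact: limE.
have -> : u \* u = (u - l) + cst (l o - (u o - u o ^+ 2)).
  by apply/funext => x; rewrite !fctE /=; have := lE x; rewrite !expr2; lra.
by apply: domD; [exact: domB | exact: (RF1_cst hEF)].
Unshelve. all: by end_near. Qed.

(** With [c = 1 + |M|], the function [w = u / (2c) + 1/2] has values in [[0, 1]], and
    [u^2 = (2c)^2 w^2 - 2c u - c^2]. *)
Lemma dom_sqr u M : F u -> (forall x, `|u x| <= M) -> F (u \* u).
Proof.
move=> Fu uM; pose c := 1 + `|M|.
have c0 : 0 < c by rewrite ltr_pwDl.
have [Fv _] := energy_affine (2 * c)^-1 2^-1 u Fu.
have F2 : F ((fun x => (2 * c)^-1 * u x + 2^-1) \*
             (fun x => (2 * c)^-1 * u x + 2^-1)).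
  apply: dom_sqr01 => // x.
  have : `|(2 * c)^-1 * u x| <= 2^-1.
    rewrite normrM gtr0_norm ?invr_gt0 ?mulr_gt0 // invfM -mulrA.
    rewrite ler_piMr // mulrC ler_pdivrMr // mul1r /c.
    by have := uM x; have := ler_norm M; lra.
  by rewrite ler_norml; lra.
have -> : u \* u = (2 * c) ^+ 2 *: ((fun x => (2 * c)^-1 * u x + 2^-1) \*
             (fun x => (2 * c)^-1 * u x + 2^-1)) +
             (- (2 * c) *: u + cst (- c ^+ 2)).
  apply/funext => x; rewrite !fctE /GRing.scale /=; field.
  by rewrite gt_eqF.
by apply: dom_lin => //; apply: dom_lin => //; exact: (RF1_cst hEF).
Qed.

Lemma bounded_dom_mul u v : F u -> F v -> bounded_fun u -> bounded_fun v ->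
  F (u \* v).
Proof.
move=> Fu Fv [M [_ bu]] [N [_ bv]].
have {}bu x : `|u x| <= M + 1 by apply: bu => //; rewrite ltrDl.
have {}bv x : `|v x| <= N + 1 by apply: bv => //; rewrite ltrDl.
have Fs := dom_sqr _ ((M + 1) + (N + 1)) (domD _ _ Fu Fv).
(* Polarization. *)
have -> : u \* v = 2^-1 *: (((u + v) \* (u + v) - u \* u) - v \* v).
  by apply/funext => x; rewrite !fctE /GRing.scale /=; field.
apply: domZ; apply: domB; last exact: dom_sqr bv.
apply: domB; last exact: dom_sqr bu.
by apply: Fs => x; apply: le_trans (ler_normD _ _) (lerD _ _).
Qed.

(** * An unbounded function when [rho] is unbounded *)

Lemma rho_sup_fin o M : (forall x, (rho E F x o <= M%:E)%E) ->
  (ereal_sup [set rho E F x y | x in [set: X] & y in [set: X]] < +oo)%E.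
Proof.
move=> hM; apply: (@le_lt_trans _ _ (M + M)%:E); last exact: ltry.
apply: ge_ereal_sup => _ [x _ [y _ <-]]; apply: ge_ereal_sup => _ [f Ff <-].
(* By the triangle inequality through [o], bounding [rho] from the base point suffices. *)
have fM z : `|f z - f o| <= M.
  by rewrite -lee_fin (le_trans _ (hM z)) //; apply: ereal_sup_ubound; exists f.
rewrite lee_fin (le_trans (ler_distD (f o) _ _)) // lerD // distrC; exact: fM.
Qed.

(** Normalize a near-optimal function affinely to be 0 at [o] and 1 at [x], clip it, and scale back
    by [|b|]; clipping does not raise the energy. *)
Lemma rho_bump x o r : rho E F x o = r%:E -> 0 < r ->
  exists f, [/\ F f, E f f <= 1, forall z, 0 <= f z, f o = 0 & r / 2 <= f x].
Proof.
move=> hr r0.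
have : ((r / 2)%:E < rho E F x o)%E by rewrite hr lte_fin; lra.
move=> /ereal_sup_gt [_ [f [Ff Ef1] <-]]; rewrite lte_fin.
set b := f x - f o => hb.
have b0 : b != 0 by rewrite -normr_gt0; lra.
have [Fg Eg] := energy_affine b^-1 (- (b^-1 * f o)) f Ff.
set g := fun x => _ in Fg Eg; have [Fc Ec] := RF5 hEF Fg.
exists (`|b| *: unit_clip g); split.
- exact: domZ.
- rewrite energyZ // real_normK ?num_real //.
  have b2 : 0 < b ^+ 2 by rewrite exprn_even_gt0.
  rewrite Eg -(ler_pM2l b2) mulrA exprVn mulfV ?gt_eqF // mul1r in Ec.
  exact: le_trans Ef1.
- move=> z; rewrite !fctE /GRing.scale /= mulr_ge0 // /unit_clip.
  by rewrite le_min ler01 le_max lexx orbT.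
- rewrite !fctE /GRing.scale /= /unit_clip /g subrr maxxx.
  by rewrite min_l // mulr0.
- rewrite !fctE /GRing.scale /= /unit_clip /g -mulrBr mulVf // max_l // minxx.
  by rewrite mulr1 ltW.
Qed.

Lemma rho_unbounded_witness o :
  ~ (ereal_sup [set rho E F x y | x in [set: X] & y in [set: X]] < +oo)%E ->
  exists2 f, F f & f o = 0 /\ forall n, exists x r,
    [/\ rho E F x o = r%:E, 8 ^+ n <= r & 2^-1 ^+ n * (r / 2) <= f x].
Proof.
move=> unb.
(* Point, distance and bump are packed in one triple so that a single choice selects all three. *)
have far n : exists z : X * R * (X -> R),
    [/\ rho E F z.1.1 o = z.1.2%:E, 8 ^+ n <= z.1.2, F z.2, E z.2 z.2 <= 1 &
    [/\ forall y, 0 <= z.2 y, z.2 o = 0 & z.1.2 / 2 <= z.2 z.1.1]].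
  apply: contrapT => none; apply: unb; apply: (@rho_sup_fin o (8 ^+ n)) => x.
  rewrite leNgt; apply/negP => h; apply: none.
  have [r hr _] := rho_fin x o; rewrite hr lte_fin in h.
  have [|f [Ff Ef f0 fo fx]] := rho_bump _ _ _ hr.
    by apply: lt_trans h; rewrite exprn_gt0.
  by exists (x, r, f); split=> //=; exact: ltW.
have [z hz] := choice far.
pose u n := 2^-1 ^+ n *: (z n).2.
have Fu n : F (u n) by apply: domZ; case: (hz n).
have Eu n : E (u n) (u n) <= (1 * 2^-1 ^+ n) ^+ 2.
  have [_ _ Fn En _] := hz n.
  by rewrite energyZ // mul1r ler_piMr // sqr_ge0.
have [l Fl hl] := dom_series 1 u ltr01 Fu Eu.
exists (l - cst (l o)); first by apply: domB => //; exact: (RF1_cst hEF).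
rewrite !fctE subrr; split=> // n; exists (z n).1.1, (z n).1.2.
have [hr r8 _ _ [_ _ hn]] := hz n; split=> //.
have cv := hl (z n).1.1 o.
rewrite -(cvg_lim _ cv) //; apply: limr_ge.
  by apply/cvg_ex; eexists; exact: cv.
have uE k x : u k x - u k o = 2^-1 ^+ k * (z k).2 x.
  have [_ _ _ _ [_ zo _]] := hz k.
  by rewrite /u !fctE /GRing.scale /= zo mulr0 subr0.
near=> N.
have nN : (n < N)%N by near: N; exact: nbhs_infty_gt.
(* All terms are nonnegative, so the [n]-th alone bounds the partial sum from below. *)
rewrite big_mkord (bigD1 (Ordinal nN)) //= uE.
apply: (@le_trans _ _ (2^-1 ^+ n * (z n).2 (z n).1.1)).
  by rewrite ler_pM2l // exprn_gt0.
rewrite lerDl sumr_ge0 // => k _; rewrite uE mulr_ge0 ?exprn_ge0 //.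
by have [_ _ _ _ [+ _ _]] := hz k; apply.
Unshelve. all: by end_near. Qed.

(** * The implications between the three properties *)

Lemma bounded_rho_finite : inhabited X -> (forall f, F f -> bounded_fun f) ->
  (ereal_sup [set rho E F x y | x in [set: X] & y in [set: X]] < +oo)%E.
Proof.
move=> [ o] bF; apply: contrapT => /(rho_unbounded_witness o)[f Ff [fo hf]].
have [M [_ hM]] := bF f Ff.
have {}hM x : f x <= M + 1.
  by apply: le_trans (ler_norm _) _; apply: hM => //; rewrite ltrDl.
(* This gives [2 |M + 1| < n + 1 <= 2^n], while [f x >= 2^-n r / 2 >= 2^n / 2]. *)
pose n := Num.truncn (2 * `|M + 1|).
have [x [r [_ r8 hx]]] := hf n.
have h2 : 2 ^+ n <= 2^-1 ^+ n * r.
  rewrite -(@ler_pM2l _ (2 ^+ n)) ?exprn_gt0 // mulrA.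
  rewrite -[X in _ <= X * _]exprMn mulfV // expr1n mul1r -exprMn.
  by apply: le_trans r8; rewrite lerXn2r ?nnegrE //; lra.
have h3 : 2 * `|M + 1| < 2 ^+ n :> R.
  apply: (@lt_le_trans _ _ n.+1%:R); first by rewrite truncnS_gt.
  by rewrite -natrX ler_nat ltn_expl.
by have := hM x; have := ler_norm (M + 1); lra.
Qed.

Lemma algebra_rho_finite : inhabited X ->
  (forall f g, F f -> F g -> F (f \* g)) ->
  (ereal_sup [set rho E F x y | x in [set: X] & y in [set: X]] < +oo)%E.
Proof.
move=> [ o] aF; apply: contrapT => /(rho_unbounded_witness o)[f Ff [fo hf]].
have Fff := aF f f Ff Ff.
set K := Num.sqrt (E (f \* f) (f \* f)).
(* Comparing [4^-n r^2 / 4 <= f(x)^2 <= r K] and dividing by [r] gives [4^-n r <= 4 K]. But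
   [r >= 8^n] makes the left side at least [2^n], which exceeds [4 K] for this [n]. *)
pose n := Num.truncn (4 * K).
have [x [r [hr r8 hx]]] := hf n.
have := rho_bound _ _ _ _ hr Fff; rewrite /= fo mulr0 subr0 -/K => h.
have r0 : 0 < r by apply: lt_le_trans r8; rewrite exprn_gt0.
have h1 : (2^-1 ^+ n * (r / 2)) ^+ 2 <= r * K.
  apply: le_trans h; rewrite ger0_norm -?expr2 ?sqr_ge0 //.
  by rewrite lerXn2r ?nnegrE // ?(le_trans _ hx) //
    mulr_ge0 ?exprn_ge0 // ltW // divr_gt0.
have h2 : 4^-1 ^+ n * r <= 4 * K.
  rewrite -(@ler_pM2l _ r) //.
  have -> : 4^-1 = 2^-1 ^+ 2 :> R by field.
  rewrite exprAC; move: h1; rewrite !expr2; lra.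
have h3 : 2 ^+ n <= 4^-1 ^+ n * r.
  rewrite -(@ler_pM2l _ (4 ^+ n)) ?exprn_gt0 // mulrA.
  rewrite -[X in _ <= X * _]exprMn mulfV // expr1n mul1r -exprMn.
  by apply: le_trans r8; rewrite lerXn2r ?nnegrE //; lra.
have h4 : 4 * K < 2 ^+ n :> R.
  apply: (@lt_le_trans _ _ n.+1%:R); first by rewrite truncnS_gt.
  by rewrite -natrX ler_nat ltn_expl.
lra.
Qed.

Lemma rho_finite_bounded f : inhabited X ->
  (ereal_sup [set rho E F x y | x in [set: X] & y in [set: X]] < +oo)%E ->
  F f -> bounded_fun f.
Proof.
move=> [ o] fin Ff; set S := ereal_sup _ in fin.
have rS x y : (rho E F x y <= S)%E.
  by apply: ereal_sup_ubound; exists x => //; exists y.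
(* The supremum is not [-oo], since it dominates the real value [rho E F o o]. *)
have [r rE] : exists r, S = r%:E.
  have [r hr _] := rho_fin o o; have := rS o o; rewrite hr.
  by case: S fin {rS} => [s| |] //; exists s.
exists (r * Num.sqrt (E f f) + `|f o|); split; first exact: num_real.
move=> M hM x _; apply: le_trans (ltW hM).
have [s hs _] := rho_fin x o.
have := rS x o; rewrite hs rE lee_fin => sr.
have := rho_bound _ _ _ _ hs Ff => h.
rewrite -[f x](subrK (f o)) (le_trans (ler_normD _ _)) // lerD2r.
by apply: (le_trans h); rewrite ler_wpM2r // sqrtr_ge0.
Qed.

End ResistanceFormTheory.

Theorem theorem4 (R : realType) (X : Type) (hX : inhabited X)
    (E : (X -> R) -> (X -> R) -> R) (F : set (X -> R))
    (hEF : resistance_form E F) :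
  ((forall f, F f -> bounded_fun f) <->
   (ereal_sup [set rho E F x y | x in [set: X] & y in [set: X]] < +oo)%E) /\
  ((ereal_sup [set rho E F x y | x in [set: X] & y in [set: X]] < +oo)%E <->
   (forall f g, F f -> F g -> F (f \* g))).
Proof.
split; split.
- exact: bounded_rho_finite.
- by move=> fin f Ff; exact: (rho_finite_bounded _ _ _ _ hEF f hX fin Ff).
- move=> fin f g Ff Fg.
  by apply: (bounded_dom_mul _ _ _ _ hEF) => //; exact: rho_finite_bounded fin _.
- exact: algebra_rho_finite.
Qed.
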